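(* Let $p$ be a complex polynomial of degree $d \geq 2$ such that $H_p = p^{-1}(H_p) = K_p$ and this set has nonempty interior, where $H_p=\operatorname{conv}J_p$. Then $p$ is affinely conjugate to a monomial $cz^d$ with $|c|=1$; that is, there exist $a\in\mathbb{C}\setminus\{0\}$, $b\in\mathbb{C}$ and $c\in\mathbb{C}$ with $|c|=1$ such that, with $g(z)=az+b$, one has $p(z) = g^{-1}\big(c\,(g(z))^d\big)$ for all $z\in\mathbb{C}$.
   Context: For a polynomial $p$ viewed as a holomorphic self-map of the Riemann sphere $\widehat{\mathbb{C}}$ (with $p(\infty)=\infty$), the Fatou set $F_p$ is the maximal open subset of $\widehat{\mathbb{C}}$ on which the iterates $\{p^{\circ n}\}_{n\in\mathbb{N}}$ form an equicontinuous family, and the Julia set $J_p$ is the complement $\widehat{\mathbb{C}}\setminus F_p$. The filled-in Julia set is $K_p=\{z\in\mathbb{C} : \{p^{\circ n}(z)\}_{n\ge 0} \text{ is bounded}\}$. $\operatorname{conv} X$ denotes the convex hull of $X \subset \mathbb{C}\cong\mathbb{R}^2$. *)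

(* Defs.v *)
From HB Require Import structures.
From mathcomp Require Import all_boot all_order all_algebra.
From mathcomp Require Import complex.
From mathcomp Require Import Rstruct.
Set Implicit Arguments. Unset Strict Implicit. Unset Printing Implicit Defensive.
Import Order.TTheory GRing.Theory Num.Theory.
Local Open Scope ring_scope.

Notation RR := Rdefinitions.R.
Notation CC := (RR[i]).

Definition cabs (z : CC) : RR := let: Complex a b := z in Num.sqrt (a ^+ 2 + b ^+ 2).

(* Riemann sphere: None is the point at infinity *)
Definition sphere := option CC.

Definition chordal (u v : sphere) : RR :=
  match u, v with
  | Some z, Some w => 2 * cabs (z - w) / Num.sqrt ((1 + cabs z ^+ 2) * (1 + cabs w ^+ 2))
  | Some z, None | None, Some z => 2 / Num.sqrt (1 + cabs z ^+ 2)
  | None, None => 0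
  end.

Definition sph_map (p : {poly CC}) (u : sphere) : sphere :=
  match u with Some z => Some p.[z] | None => None end.

Definition sph_open (U : sphere -> Prop) : Prop :=
  forall x, U x -> exists r : RR, 0 < r /\ forall y, chordal x y < r -> U y.

Definition equicont_on (p : {poly CC}) (U : sphere -> Prop) : Prop :=
  forall x, U x -> forall eps : RR, 0 < eps -> exists delta : RR, 0 < delta /\
    forall (n : nat) y, U y -> chordal x y < delta ->
      chordal (iter n (sph_map p) x) (iter n (sph_map p) y) < eps.

(* Fatou set = union of all open sets on which the iterates are equicontinuous
   (this union is the maximal such open set) *)
Definition fatou (p : {poly CC}) (u : sphere) : Prop :=
  exists U : sphere -> Prop, sph_open U /\ equicont_on p U /\ U u.

Definition julia (p : {poly CC}) (u : sphere) : Prop := ~ fatou p u.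

Definition filled_julia (p : {poly CC}) (z : CC) : Prop :=
  exists M : RR, forall n : nat, cabs (iter n (horner p) z) <= M.

Definition conv (X : CC -> Prop) (z : CC) : Prop :=
  exists (n : nat) (x : 'I_n -> CC) (w : 'I_n -> RR),
    (forall i, X (x i)) /\ (forall i, 0 <= w i) /\ \sum_(i < n) w i = 1 /\
    z = \sum_(i < n) (w i)%:C%C * x i.

(* H_p = conv J_p  (J_p lies in C since oo is in the Fatou set) *)
Definition hull_julia (p : {poly CC}) : CC -> Prop :=
  conv (fun z => julia p (Some z)).

(* Main.v *)
(* The body [K = H_p] is compact and convex, and the barycentre [g] of a fibre
   [p^-1(w)], which does not depend on [w], is an interior point. Let [X] be
   the frontier of [K]. For [z] in [K] and a normal [v] supporting [K] at [z],
   let [m] be such that [m |z-s|^2 <= Re (conj v (z-s)) <= |z-s|^2 / 2] for all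
   [s] in [X]: a disc inside [K] and a disc containing [K] both touch [X] at [z].
   Because [p'(z)/(p(z)-s)] is the sum of the [1/(z-u)] over [p(u) = s],
   the map [(z, v) |-> (p(z), v p'(z)/d)] preserves these inequalities. The
   largest disc about [g] inside [K] yields, after one step, a state with
   [m > 0], and by compactness there is one with [m] maximal. For it the outer
   circle meets [X] at a further point (otherwise the image state would have a
   larger [m]), and the preimages of the contact points of the image state are
   contact points. Each fibre over [X] has two distinct points, so two whole
   fibres lie on one circle, which forces [p = a (X - c)^d + q]; here [c = g],
   and three contact points of the next state determine its centre, so [q = g]. *)
Require Import Defs.
From HB Require Import structures.
From mathcomp Require Import all_boot all_order all_algebra.
From mathcomp Require Import complex.
From mathcomp Require Import Rstruct.
From mathcomp Require Import ring lra zify.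
From mathcomp Require Import boolp classical_sets filter reals topology normedtype.
Set Implicit Arguments. Unset Strict Implicit. Unset Printing Implicit Defensive.
Import Order.TTheory GRing.Theory Num.Theory.
Import numFieldNormedType.Exports.
Local Open Scope ring_scope.

Local Notation Re := (@complex.Re RR).
Local Notation Im := (@complex.Im RR).

(** * The Euclidean inner product and the modulus on [CC] *)

Definition dot (a b : CC) : RR := Re a * Re b + Im a * Im b.

Lemma cabs0 : cabs 0 = 0.
Proof. exact: (@ComplexField.Normc.normc0 RR). Qed.

Lemma cabs0_eq (z : CC) : cabs z = 0 -> z = 0.
Proof. exact: (@ComplexField.Normc.eq0_normc RR). Qed.

Lemma cabsM (x y : CC) : cabs (x * y) = cabs x * cabs y.
Proof. exact: (@ComplexField.Normc.normcM RR). Qed.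

Lemma cabsD (x y : CC) : cabs (x + y) <= cabs x + cabs y.
Proof. exact: (@le_normcD RR). Qed.

Lemma cabsN (x : CC) : cabs (- x) = cabs x.
Proof. exact: (@normcN RR). Qed.

Lemma cabsB (x y : CC) : cabs (x - y) = cabs (y - x).
Proof. by rewrite -cabsN opprB. Qed.

Lemma cabs_ge0 (z : CC) : 0 <= cabs z.
Proof. by case: z => a b; exact: sqrtr_ge0. Qed.

Lemma cabs_sqr (z : CC) : cabs z ^+ 2 = dot z z.
Proof.
by case: z => a b; rewrite /cabs /dot /= sqr_sqrtr -?expr2 // addr_ge0 ?sqr_ge0.
Qed.

Lemma cabs_gt0 (z : CC) : z != 0 -> 0 < cabs z.
Proof.
move=> z0; rewrite lt_neqAle cabs_ge0 andbT eq_sym.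
by apply: contra z0 => /eqP/cabs0_eq ->.
Qed.

Lemma cabsC (t : RR) : cabs t%:C%C = `|t|.
Proof. by rewrite /cabs /= expr0n /= addr0 sqrtr_sqr. Qed.

Lemma cabs1 : cabs 1 = 1.
Proof. by rewrite -[1]/(1%:C%C) cabsC normr1. Qed.

Lemma cabsX (z : CC) n : cabs (z ^+ n) = cabs z ^+ n.
Proof. by elim: n => [|n IH]; rewrite ?expr0 ?cabs1 // !exprS cabsM IH. Qed.

Lemma cabs_triangle (y x z : CC) : cabs (x - z) <= cabs (x - y) + cabs (y - z).
Proof. by have := cabsD (x - y) (y - z); rewrite addrA subrK. Qed.

Lemma cabs_prod (I : Type) (r : seq I) (F : I -> CC) :
  cabs (\prod_(i <- r) F i) = \prod_(i <- r) cabs (F i).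
Proof. exact: (big_morph cabs cabsM cabs1). Qed.

Lemma Re_le_cabs (z : CC) : `|Re z| <= cabs z.
Proof.
rewrite -ler_sqr ?nnegrE ?cabs_ge0 ?normr_ge0 // cabs_sqr /dot -normrX.
by rewrite ger0_norm ?sqr_ge0 // expr2 lerDl -expr2 sqr_ge0.
Qed.

Lemma Im_le_cabs (z : CC) : `|Im z| <= cabs z.
Proof.
rewrite -ler_sqr ?nnegrE ?cabs_ge0 ?normr_ge0 // cabs_sqr /dot -normrX.
by rewrite ger0_norm ?sqr_ge0 // expr2 lerDr -expr2 sqr_ge0.
Qed.

Lemma cabs_le_ReIm (z : CC) : cabs z <= `|Re z| + `|Im z|.
Proof.
rewrite -ler_sqr ?nnegrE ?cabs_ge0 ?addr_ge0 ?normr_ge0 // cabs_sqr /dot.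
rewrite sqrrD -!normrX !(ger0_norm (sqr_ge0 _)) -!expr2.
by rewrite addrAC lerDl mulrn_wge0 // mulr_ge0.
Qed.

Lemma ReD (x y : CC) : Re (x + y) = Re x + Re y. Proof. by case: x; case: y. Qed.
Lemma ImD (x y : CC) : Im (x + y) = Im x + Im y. Proof. by case: x; case: y. Qed.
Lemma ReN (x : CC) : Re (- x) = - Re x. Proof. by case: x. Qed.
Lemma ImN (x : CC) : Im (- x) = - Im x. Proof. by case: x. Qed.
Lemma ReM (x y : CC) : Re (x * y) = Re x * Re y - Im x * Im y.
Proof. by case: x; case: y. Qed.
Lemma ImM (x y : CC) : Im (x * y) = Re x * Im y + Im x * Re y.
Proof. by case: x; case: y. Qed.
Lemma ReC (t : RR) : Re t%:C%C = t. Proof. by []. Qed.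
Lemma ImC (t : RR) : Im t%:C%C = 0. Proof. by []. Qed.
Definition ReImE := (ReD, ImD, ReN, ImN, ReM, ImM, ReC, ImC).

Lemma complex_ext (x y : CC) : Re x = Re y -> Im x = Im y -> x = y.
Proof. by case: x => a b; case: y => c e /= -> ->. Qed.

Lemma dotDr v x y : dot v (x + y) = dot v x + dot v y.
Proof. rewrite /dot !ReImE; ring. Qed.
Lemma dotNr v x : dot v (- x) = - dot v x.
Proof. rewrite /dot !ReImE; ring. Qed.
Lemma dotNl v x : dot (- x) v = - dot x v.
Proof. rewrite /dot !ReImE; ring. Qed.
Lemma dotZr v (t : RR) x : dot v (t%:C%C * x) = t * dot v x.
Proof. rewrite /dot !ReImE; ring. Qed.
Lemma dotZl v (t : RR) x : dot (t%:C%C * x) v = t * dot x v.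
Proof. rewrite /dot !ReImE; ring. Qed.
Lemma dotC x y : dot x y = dot y x.
Proof. rewrite /dot; ring. Qed.
Lemma dot0l x : dot 0 x = 0.
Proof. by rewrite /dot !mul0r addr0. Qed.
Lemma dot0r x : dot x 0 = 0.
Proof. by rewrite dotC dot0l. Qed.

Lemma dot_sqrD x y : dot (x + y) (x + y) = dot x x + 2 * dot x y + dot y y.
Proof. rewrite /dot !ReImE; ring. Qed.

Lemma dot_sqrB x y : dot (x - y) (x - y) = dot x x - 2 * dot y x + dot y y.
Proof. rewrite /dot !ReImE; ring. Qed.

Lemma dot_sumr (I : Type) (r : seq I) v (F : I -> CC) :
  dot v (\sum_(i <- r) F i) = \sum_(i <- r) dot v (F i).
Proof. exact: (big_morph (dot v) (dotDr v) (dot0r v)). Qed.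

Lemma dot_ge0 z : 0 <= dot z z.
Proof. by rewrite -cabs_sqr sqr_ge0. Qed.

Lemma dot_gt0 z : z != 0 -> 0 < dot z z.
Proof. by move=> z0; rewrite -cabs_sqr exprn_gt0 // cabs_gt0. Qed.

Lemma dot_le_cabs x y : dot x y <= cabs x * cabs y.
Proof.
case: (lerP (dot x y) 0) => [h|h]; first by rewrite (le_trans h) ?mulr_ge0 ?cabs_ge0.
rewrite -ler_sqr ?nnegrE ?mulr_ge0 ?cabs_ge0 ?(ltW h) // exprMn !cabs_sqr /dot.
rewrite -subr_ge0.
set e := (X in 0 <= X).
have -> : e = (Re x * Im y - Im x * Re y) ^+ 2 by rewrite /e; ring.
exact: sqr_ge0.
Qed.

(** This form turns the partial fractions of [p' / (p - s)] into quotients of inner products. *)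
Lemma Re_div (v w : CC) : w != 0 -> Re (v / w) = dot v w / dot w w.
Proof.
move=> w0; have dw : dot w w != 0 by rewrite gt_eqF ?dot_gt0.
rewrite -[v in dot v w](divfK w0 v); move: (v / w) => u.
rewrite -[LHS](mulfK dw); congr (_ / _); rewrite /dot !ReImE; ring.
Qed.

(** * Bounds and Lipschitz constants for polynomials on discs *)

Lemma horner_bounded (q : {poly CC}) (M : RR) :
  exists B : RR, 0 <= B /\ forall w, cabs w <= M -> cabs q.[w] <= B.
Proof.
case: (lerP 0 M) => [M0|Mn]; last first.
  by exists 0; split=> // w hw; move: (cabs_ge0 w); lra.
elim/poly_ind: q => [|q c [B [B0 IH]]].
  by exists 0; split=> // w _; rewrite horner0 cabs0.
exists (B * M + cabs c); split=> [|w hw].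
  by rewrite addr_ge0 ?mulr_ge0 ?cabs_ge0.
rewrite hornerMXaddC (le_trans (cabsD _ _)) // lerD2r cabsM.
by rewrite ler_pM ?cabs_ge0 ?IH.
Qed.

Lemma horner_lipschitz (q : {poly CC}) (M : RR) :
  exists B : RR, 0 < B /\ forall x y, cabs x <= M -> cabs y <= M ->
    cabs (q.[x] - q.[y]) <= B * cabs (x - y).
Proof.
case: (lerP 0 M) => [M0|Mn]; last first.
  by exists 1; split=> // x y hx; move: (cabs_ge0 x); lra.
elim/poly_ind: q => [|q c [B [B0 IH]]].
  by exists 1; split=> // x y _ _; rewrite !horner0 subrr cabs0 mul1r cabs_ge0.
have [C [C0 hC]] := horner_bounded q M.
exists (B * M + C + 1); split=> [|x y hx hy].
  by rewrite ltr_wpDl // addr_ge0 ?mulr_ge0 ?(ltW B0).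
rewrite !hornerMXaddC.
have -> : q.[x] * x + c - (q.[y] * y + c) = (q.[x] - q.[y]) * x + q.[y] * (x - y).
  by ring.
apply: (le_trans (cabsD _ _)); rewrite !cabsM.
have h1 : cabs (q.[x] - q.[y]) * cabs x <= B * cabs (x - y) * M.
  by rewrite ler_pM ?cabs_ge0 ?IH.
have h2 : cabs q.[y] * cabs (x - y) <= C * cabs (x - y).
  by rewrite ler_wpM2r ?cabs_ge0 ?hC.
have := cabs_ge0 (x - y); nra.
Qed.

(** * Fibres of a polynomial and their common barycentre *)

(** [us] lists the preimages of [s] with multiplicity; encoding this as a factorisation makes sums
    over [us] sums over all roots. *)
Definition fiber (p : {poly CC}) (s : CC) (us : seq CC) :=
  p - s%:P = lead_coef p *: \prod_(u <- us) ('X - u%:P).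

(** By Vieta, in degree at least 2, the mean of the roots of [p - s%:P] for every [s]. *)
Definition barycenter (p : {poly CC}) : CC :=
  - p`_((size p).-2) / ((size p).-1%:R * lead_coef p).

Lemma lead_coef_neq0 (p : {poly CC}) : (1 < size p)%N -> lead_coef p != 0.
Proof. by rewrite lead_coef_eq0 -size_poly_eq0; case: (size p). Qed.

Lemma fiber_ex (p : {poly CC}) s : (1 < size p)%N -> exists us, fiber p s us.
Proof.
move=> p1; have [us] := closed_field_poly_normal (p - s%:P).
rewrite -polyCN lead_coefDl; first by exists us; rewrite /fiber -polyCN.
by rewrite (leq_ltn_trans (size_polyC_leq1 _)).
Qed.

Lemma fiber_size (p : {poly CC}) s us :
  (1 < size p)%N -> fiber p s us -> size us = (size p).-1.
Proof.
move=> p1 h; have := congr1 (fun q : {poly CC} => size q) h.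
rewrite -polyCN size_polyDl; last by rewrite (leq_ltn_trans (size_polyC_leq1 _)).
by rewrite size_scale ?lead_coef_neq0 // size_prod_XsubC => ->.
Qed.

Lemma fiber_sum (p : {poly CC}) s us : (2 < size p)%N -> fiber p s us ->
  \sum_(u <- us) u = (size p).-1%:R * barycenter p.
Proof.
move=> p2 h; have p1 := ltnW p2; have hs := fiber_size p1 h.
have a0 := lead_coef_neq0 p1.
have d0 : (size p).-1%:R != 0 :> CC by rewrite pnatr_eq0; case: (size p) p2 => [|[]].
have := congr1 (fun q : {poly CC} => q`_((size p).-2)) h.
rewrite coefZ -[X in _ = _ * _`_X]/((size p).-1.-1) -hs coefPn_prod_XsubC; last first.
  by rewrite hs; case: (size p) p2 => [|[]].
(* The index is at least 1, so subtracting the constant [s] leaves this coefficient alone. *)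
rewrite coefB coefC hs; have -> : ((size p).-2 == 0)%N = false.
  by case: (size p) p2 => [|[|[]]].
rewrite subr0 /barycenter => ->; field; exact/andP.
Qed.

Lemma fiber_horner (p : {poly CC}) s us (z : CC) : fiber p s us ->
  p.[z] - s = lead_coef p * \prod_(u <- us) (z - u).
Proof.
move=> h; have := congr1 (fun q : {poly CC} => q.[z]) h.
rewrite hornerD hornerN hornerC hornerZ => ->; congr (_ * _).
by rewrite horner_prod; apply: eq_bigr => u _; rewrite hornerXsubC.
Qed.

Lemma fiber_mem (p : {poly CC}) s us u : (1 < size p)%N -> fiber p s us ->
  (u \in us) = (p.[u] == s).
Proof.
move=> p1 h; rewrite -subr_eq0 (fiber_horner _ h) mulf_eq0.
rewrite (negPf (lead_coef_neq0 p1)) /=; elim: us {h} => [|x us IH].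
  by rewrite big_nil oner_eq0.
by rewrite big_cons in_cons mulf_eq0 IH subr_eq0.
Qed.

Lemma deriv_prod_XsubC (us : seq CC) z : z \notin us ->
  (\prod_(u <- us) ('X - u%:P))^`().[z] =
  \prod_(u <- us) (z - u) * \sum_(u <- us) (z - u)^-1.
Proof.
elim: us => [|x us IH]; first by rewrite !big_nil mulr0 derivC horner0.
rewrite in_cons negb_or => /andP[zx zus]; rewrite !big_cons derivM derivXsubC mul1r.
rewrite hornerD hornerM IH // hornerXsubC horner_prod.
under eq_bigr do rewrite hornerXsubC.
by rewrite mulrDr mulrAC mulfV ?subr_eq0 // mul1r mulrA.
Qed.

Lemma fiber_log_deriv (p : {poly CC}) s us (z : CC) :
  (1 < size p)%N -> fiber p s us -> p.[z] != s ->
  p^`().[z] = (p.[z] - s) * \sum_(u <- us) (z - u)^-1.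
Proof.
move=> p1 h zs; have := congr1 (fun q : {poly CC} => (q^`()).[z]) h.
rewrite derivB derivC subr0 derivZ hornerZ deriv_prod_XsubC.
  by rewrite mulrA -(fiber_horner _ h).
by rewrite (fiber_mem _ p1 h).
Qed.

(* [v] is thought of as an outer normal at [z], carried to [p.[z]] by the
   derivative; since [p' / (p - s)] is the sum of the [1 / (z - u)], the ratio
   [dot v (z - u) / |z - u|^2] is replaced by its mean over the fibre. *)
Lemma dot_transport (p : {poly CC}) s us (z v : CC) :
  (2 < size p)%N -> fiber p s us -> p.[z] != s ->
  dot (v * p^`().[z] / (size p).-1%:R) (p.[z] - s) =
  dot (p.[z] - s) (p.[z] - s) *
    ((\sum_(u <- us) dot v (z - u) / dot (z - u) (z - u)) / (size p).-1%:R).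
Proof.
move=> p2 h zs; have p1 := ltnW p2; set d := (size p).-1.
have d0 : d%:R != 0 :> RR by rewrite pnatr_eq0 /d; case: (size p) p2 => [|[]].
have w0 : p.[z] - s != 0 by rewrite subr_eq0.
have w1 : dot (p.[z] - s) (p.[z] - s) != 0 by rewrite gt_eqF ?dot_gt0.
have zus : z \notin us by rewrite (fiber_mem _ p1 h).
rewrite (fiber_log_deriv p1 h zs).
set w := p.[z] - s in w0 w1 *.
have -> : \sum_(u <- us) dot v (z - u) / dot (z - u) (z - u) =
          Re (v * \sum_(u <- us) (z - u)^-1).
  rewrite mulr_sumr (big_morph Re ReD (erefl : Re 0 = 0)).
  rewrite !big_seq; apply: eq_bigr => u hu; rewrite Re_div // subr_eq0.
  by apply: contraNneq zus => ->.
set S := \sum_(u <- us) _.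
have -> : v * (w * S) / d%:R = (d%:R^-1)%:C%C * (v * S * w).
  rewrite (fmorphV (real_complex RR)) /= rmorph_nat; ring.
rewrite dotZl /dot !ReImE; ring.
Qed.

(** * Limits along an ultrafilter on [nat] *)

Section UltraLimits.
Variable R : realType.
Implicit Types (u v : nat -> R) (a b : R) (U : set_system nat).

Definition ulim U u a : Prop := (u @ U --> a)%classic.

(** Take an ultrafilter finer than the eventuality filter: compactness of [[-M, M]] makes every
    bounded sequence converge along it, so several sequences get limits at once, without extracting
    subsequences. *)
Lemma ultralimits : exists U, ProperFilter U /\
  (forall N, U [set n | (N <= n)%N]%classic) /\
  forall u M, (forall n, `|u n| <= M) -> exists l : R, ulim U u l.
Proof.
have [U [UU oU]] := @ultraFilterLemma nat (nbhs eventually) _.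
exists U; split; first exact: ultra_proper.
split=> [N|u M hu]; first by apply: oU; exists N.
have [|l [_ cl]] := @segment_compact R (- M) M (u @ U)%classic.
  rewrite /= /fmap /=; apply: (@filterE nat U) => n.
  by rewrite /= in_itv /=; move: (hu n); rewrite ler_norml.
exists l => A lA; have [//|UC] := in_ultra_setVsetC (u @^-1` A)%classic UU.
by have [x []] := cl (~` A)%classic A UC lA.
Qed.

Variable U : set_system nat.
Hypothesis PU : ProperFilter U.

Lemma ulim_dist u a (e : R) : ulim U u a -> 0 < e -> U [set n | `|u n - a| < e]%classic.
Proof.
move=> ua e0; have /cvgrPdist_lt /(_ _ e0) := ua.
by apply: filterS => n /=; rewrite distrC.
Qed.

Lemma ulim_le u v a b : ulim U u a -> ulim U v b -> (forall n, u n <= v n) -> a <= b.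
Proof.
move=> ua vb h; rewrite leNgt; apply/negP => ba.
have e0 : 0 < (a - b) / 2 by lra.
have := @filterI nat U PU _ _ (ulim_dist ua e0) (ulim_dist vb e0).
move=> /filter_ex [n [/= h1 h2]]; have {}h := h n.
by move: h1 h2; rewrite !ltr_norml => /andP[? ?] /andP[? ?]; lra.
Qed.

Lemma ulim_near2 u v a b (e : R) : ulim U u a -> ulim U v b -> 0 < e ->
  exists n, `|u n - a| < e /\ `|v n - b| < e.
Proof.
move=> ua vb e0; have := @filterI nat U PU _ _ (ulim_dist ua e0) (ulim_dist vb e0).
by move=> /filter_ex [n [/= h1 h2]]; exists n.
Qed.

Lemma ulim_cst a : ulim U (fun=> a) a.
Proof. exact: cvg_cst. Qed.

Lemma ulimB u v a b : ulim U u a -> ulim U v b -> ulim U (fun n => u n - v n) (a - b).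
Proof. exact: cvgB. Qed.

Lemma ulimD u v a b : ulim U u a -> ulim U v b -> ulim U (fun n => u n + v n) (a + b).
Proof. exact: cvgD. Qed.

Lemma ulimM u v a b : ulim U u a -> ulim U v b -> ulim U (fun n => u n * v n) (a * b).
Proof. exact: cvgM. Qed.

Hypothesis U_oo : forall N, U [set n | (N <= n)%N]%classic.

(** Membership of the tails in [U] makes [n.+1%:R^-1] small on a set of [U]. *)
Lemma ulim_harmonic u a b : ulim U u a -> (forall n, b - n.+1%:R^-1 <= u n) -> b <= a.
Proof.
move=> ua h; rewrite leNgt; apply/negP => ab.
have e0 : 0 < (b - a) / 2 by lra.
have [N hN] : exists N : nat, ((b - a) / 2)^-1 < N%:R.
  by exists (Num.bound ((b - a) / 2)^-1); rewrite archi_boundP // invr_ge0 ltW.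
have := @filterI nat U PU _ _ (ulim_dist ua e0) (U_oo N).
move=> /filter_ex [n [/= h1 h2]]; have {}h := h n.
have hn : n.+1%:R^-1 < (b - a) / 2.
  rewrite -[X in _ < X]invrK ltf_pV2 ?posrE ?invr_gt0 ?ltr0n //.
  by rewrite (lt_le_trans hN) // ler_nat (leq_trans h2).
move: (n.+1%:R^-1) h hn h1 => c h hn; rewrite ltr_norml => /andP[? ?]; lra.
Qed.

End UltraLimits.

Definition clim (U : set_system nat) (z : nat -> CC) (l : CC) :=
  ulim U (fun n => Re (z n)) (Re l) /\ ulim U (fun n => Im (z n)) (Im l).

Section ComplexUltraLimits.
Variables (U : set_system nat).
Hypothesis PU : ProperFilter U.

Lemma clim_cst c : clim U (fun=> c) c.
Proof. by split; exact: ulim_cst. Qed.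

Lemma climB z w a b : clim U z a -> clim U w b -> clim U (fun n => z n - w n) (a - b).
Proof.
move=> [za za'] [wb wb']; split; rewrite !ReImE.
  by under [X in ulim U X]eq_fun do rewrite !ReImE; exact: ulimB.
by under [X in ulim U X]eq_fun do rewrite !ReImE; exact: ulimB.
Qed.

Lemma ulim_dot z w a b : clim U z a -> clim U w b ->
  ulim U (fun n => dot (z n) (w n)) (dot a b).
Proof. by move=> [za za'] [wb wb']; apply: ulimD; exact: ulimM. Qed.

Lemma clim_near z l e : clim U z l -> 0 < e -> exists n, cabs (z n - l) < e.
Proof.
move=> [zr zi] e0; have e2 : 0 < e / 2 by rewrite divr_gt0.
have [n [h1 h2]] := ulim_near2 PU zr zi e2; exists n.
by apply: (le_lt_trans (cabs_le_ReIm _)); rewrite !ReImE; lra.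
Qed.

End ComplexUltraLimits.

(** * Topology of completely invariant convex bodies *)

Definition inner (K : CC -> Prop) (z : CC) :=
  exists r : RR, 0 < r /\ forall w, cabs (w - z) < r -> K w.

(** For closed [K] this is the topological boundary. *)
Definition frontier (K : CC -> Prop) (z : CC) := K z /\ ~ inner K z.

(** The geometric content of [H_p = p^-1(H_p) = K_p]; the geometry below relies on these properties
    alone. *)
Record invariant_body (p : {poly CC}) (K : CC -> Prop) (D : RR) : Prop := InvariantBody {
  body_size : (2 < size p)%N;
  body_convex : forall x y (t : RR), K x -> K y -> 0 <= t -> t <= 1 ->
    K (t%:C%C * x + (1 - t)%:C%C * y);
  body_invariant : forall z, K z <-> K p.[z];
  body_closed : forall z, ~ K z ->
    exists e : RR, 0 < e /\ forall w, cabs (w - z) < e -> ~ K w;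
  body_bounded : forall z, K z -> cabs z <= D;
  body_inner : exists z, inner K z
}.

Section InvariantBodyTopology.
Variables (p : {poly CC}) (K : CC -> Prop) (D : RR).
Hypothesis H : invariant_body p K D.
Let p2 := body_size H.
Let p1 : (1 < size p)%N := ltnW p2.
Let g := barycenter p.

Lemma innerW z : inner K z -> K z.
Proof. by move=> [r [r0 h]]; apply: h; rewrite subrr cabs0. Qed.

Lemma body_mean (us : seq CC) : us != [::] -> (forall u, u \in us -> K u) ->
  K ((\sum_(u <- us) u) / (size us)%:R).
Proof.
elim: us => // x us IH _ hK; have [->|us0] := eqVneq us [::].
  by rewrite big_seq1 divr1; apply: hK; rewrite mem_head.
have {}IH : K ((\sum_(u <- us) u) / (size us)%:R).
  by apply: IH => // u hu; apply: hK; rewrite in_cons hu orbT.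
have n0 : (0 < size us)%N by case: (us) us0.
(* [t] is the weight of the new point when the list grows to [n.+1] elements. *)
set n := size us in IH n0 *; set t : RR := n.+1%:R^-1.
have t0 : 0 <= t by rewrite invr_ge0 ler0n.
have t1 : t <= 1 by rewrite invf_le1 ?ltr0n // ler1n.
have := body_convex H (hK x (mem_head _ _)) IH t0 t1; congr K.
have n0' : n%:R != 0 :> CC by rewrite pnatr_eq0 -lt0n.
have n1' : n.+1%:R != 0 :> CC by rewrite pnatr_eq0.
have -> : t%:C%C = n.+1%:R^-1 :> CC by rewrite (fmorphV (real_complex RR)) rmorph_nat.
have -> : (1 - t)%:C%C = 1 - n.+1%:R^-1 :> CC.
  by rewrite (rmorphB (real_complex RR)) (fmorphV (real_complex RR)) rmorph_nat.
rewrite big_cons /= -/n; field.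
by rewrite n0' addrC natr1 n1'.
Qed.

(** The open mapping property made explicit: if every preimage [u] of [w] had [|u - z| >= r], the
    factorisation of [p - w] would give [|p(z) - w| >= |a| r^d]. *)
Lemma inner_horner z : inner K z -> inner K p.[z].
Proof.
move=> [r [r0 h]]; set a := cabs (lead_coef p).
have a0 : 0 < a by rewrite cabs_gt0 ?lead_coef_neq0.
exists (a * r ^+ (size p).-1); split=> [|w hw]; first by rewrite mulr_gt0 ?exprn_gt0.
have [us hus] := fiber_ex w p1.
case: (pselect (exists2 u, u \in us & cabs (u - z) < r)) => [[u hu hr]|hn].
  move: hu; rewrite (fiber_mem _ p1 hus) => /eqP <-.
  by apply: (proj1 (body_invariant H u)); exact: h.
exfalso; move: hw; rewrite cabsB (fiber_horner _ hus) cabsM cabs_prod -/a.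
rewrite ltr_pM2l // ltNge => /negP; apply.
have -> : r ^+ (size p).-1 = \prod_(u <- us) r.
  rewrite -(fiber_size p1 hus); elim: (us) => [|x s IH]; first by rewrite big_nil.
  by rewrite big_cons exprS IH.
rewrite !big_seq ler_prod // => u hu.
rewrite ltW //= cabsB leNgt; apply/negP => hr; apply: hn; exists u => //.
Qed.

Lemma inner_preim z : inner K p.[z] -> inner K z.
Proof.
move=> [r [r0 h]]; have [B [B0 hB]] := horner_lipschitz p (cabs z + 1).
exists (Num.min 1 (r / B)); split=> [|w]; first by rewrite lt_min ltr01 divr_gt0.
rewrite lt_min => /andP[w1 wr]; apply/(body_invariant H); apply: h.
apply: (le_lt_trans (hB _ _ _ _)).
- by have := cabsD z (w - z); rewrite addrC subrK; lra.
- by rewrite lerDl.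
- by rewrite mulrC -ltr_pdivlMr.
Qed.

Lemma frontier_preim z : frontier K p.[z] -> frontier K z.
Proof.
move=> [hK hn]; split; first exact/(body_invariant H).
by move=> hi; apply: hn; exact: inner_horner.
Qed.

(** The fibre over an inner point consists of inner points. Shifting all of it by the same small
    [w - g] stays in [K], and the mean of the shifted fibre is [w]. *)
Lemma inner_barycenter : inner K g.
Proof.
have [z0 i0] := body_inner H; have [us hus] := fiber_ex z0 p1.
have hi u : u \in us -> inner K u.
  by rewrite (fiber_mem _ p1 hus) => /eqP e; apply: inner_preim; rewrite e.
have [r [r0 hr]] : exists r : RR, 0 < r /\
    forall u, u \in us -> forall w, cabs (w - u) < r -> K w.
  elim: us {hus} hi => [|x us IH] hi; first by exists 1.
  have [u hu|r [r0 hr]] := IH; first by apply: hi; rewrite in_cons hu orbT.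
  have [s [s0 hs]] := hi x (mem_head _ _).
  exists (Num.min r s); split=> [|u]; first by rewrite lt_min r0.
  rewrite in_cons => /orP[/eqP ->|hu] w; rewrite lt_min => /andP[h1 h2]; first exact: hs.
  exact: hr h1.
exists r; split=> // w hw.
have d0 : (size p).-1 != 0%N by case: (size p) p2 => [|[]].
have us0 : map (fun u => u + (w - g)) us != [::].
  by rewrite -size_eq0 size_map (fiber_size p1 hus).
have := body_mean us0; rewrite size_map (fiber_size p1 hus) big_map big_split /=.
rewrite (fiber_sum p2 hus) -/g.
have -> : \sum_(u <- us) (w - g) = (w - g) *+ (size p).-1.
  rewrite -(fiber_size p1 hus); elim: (us) => [|x s IH]; first by rewrite big_nil.
  by rewrite big_cons mulrS IH.
have -> : ((size p).-1%:R * g + (w - g) *+ (size p).-1) / (size p).-1%:R = w.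
  by rewrite -[(w - g) *+ _]mulr_natl -mulrDr [g + _]addrC subrK mulrC mulKf // pnatr_eq0.
apply=> _ /mapP[u hu ->]; apply: (hr u hu).
by rewrite addrAC subrr add0r.
Qed.

Lemma frontier_closed z : ~ frontier K z ->
  exists e : RR, 0 < e /\ forall w, cabs (w - z) < e -> ~ frontier K w.
Proof.
move=> hn; case: (pselect (K z)) => [Kz|/(body_closed H)[e [e0 he]]]; last first.
  by exists e; split=> // w /he hw [].
have [r [r0 hr]] : inner K z by apply: contrapT => hi; apply: hn.
exists r; split=> // w hw [_]; apply; exists (r - cabs (w - z)).
by split=> [|x hx]; [rewrite subr_gt0 | apply: hr; have := cabs_triangle w x z; lra].
Qed.

(** Take the last parameter at which the segment is in [K]: closedness keeps that point in [K], and
    an inner point would allow a later parameter. *)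
Lemma frontier_segment x y : K x -> ~ K y ->
  exists t : RR, [/\ 0 <= t, t <= 1 & frontier K (x + t%:C%C * (y - x))].
Proof.
move=> Kx nKy; pose f (t : RR) := x + t%:C%C * (y - x).
have fE t s : cabs (f t - f s) = `|t - s| * cabs (y - x).
  by rewrite /f opprD addrACA subrr add0r -mulrBl -rmorphB cabsM cabsC.
have f0 : f 0 = x by rewrite /f mul0r addr0.
have f1 : f 1 = y by rewrite /f mul1r addrC subrK.
have c0 : 0 < cabs (y - x).
  by rewrite cabs_gt0 // subr_eq0; apply/eqP => e; apply: nKy; rewrite e.
pose T : set RR := [set t | [/\ 0 <= t, t <= 1 & K (f t)]]%classic.
have T0 : T 0 by split; rewrite ?f0.
have supT : has_sup T by split; [exists 0 | exists 1 => t []].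
have s0 : 0 <= sup T by exact: sup_upper_bound.
have s1 : sup T <= 1 by apply: ge_sup => [|t []]; first by exists 0.
exists (sup T); split=> //; split.
  apply: contrapT => /(body_closed H)[e [e0 he]].
  have ec : 0 < e / cabs (y - x) by rewrite divr_gt0.
  have [t [t0 t1 Kt] ht] := sup_adherent ec supT.
  refine (he (f t) _ Kt); rewrite fE -ltr_pdivlMr // ltr_norml.
  have : t <= sup T by apply: sup_upper_bound.
  by move=> ?; apply/andP; split; lra.
move=> [r [r0 hr]]; have sn1 : sup T < 1.
  rewrite lt_neqAle s1 andbT; apply/eqP => e; apply: nKy; rewrite -f1 -e.
  by apply: hr; rewrite subrr cabs0.
pose t := Num.min 1 (sup T + r / cabs (y - x) / 2).
have rc : 0 < r / cabs (y - x) by rewrite divr_gt0.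
have st : sup T < t by rewrite lt_min sn1 /=; lra.
have t1 : t <= 1 by rewrite ge_min lexx.
have tr : t - sup T < r / cabs (y - x).
  have : t <= sup T + r / cabs (y - x) / 2 by rewrite ge_min lexx orbT.
  by lra.
have : t <= sup T; last by lra.
apply: sup_upper_bound => //; split=> //; first lra.
by apply: hr; rewrite fE -ltr_pdivlMr // ger0_norm // subr_ge0 ltW.
Qed.

Lemma outside_body : exists y, ~ K y.
Proof.
exists (`|D| + 1)%:C%C => /(body_bounded H); rewrite cabsC ger0_norm ?addr_ge0 //.
by have := ler_norm D; lra.
Qed.

Lemma frontier_ex : exists z, frontier K z.
Proof.
have [y hy] := outside_body.
by have [t [_ _ ht]] := frontier_segment (innerW inner_barycenter) hy; eexists; exact: ht.
Qed.

End InvariantBodyTopology.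

(** * Existence of maxima by compactness *)

(** Follow a sequence on which [h] comes within [n.+1%:R^-1] of its supremum; the last hypothesis
    combines sequential compactness of [A] with upper semicontinuity of [h]. *)
Lemma attained (T : Type) (A : T -> Prop) (h : T -> RR) (M : RR) :
  (exists x, A x) -> (forall x, A x -> h x <= M) ->
  (forall x : nat -> T, (forall n, A (x n)) ->
    exists x0, A x0 /\ forall b, (forall n, b - n.+1%:R^-1 <= h (x n)) -> b <= h x0) ->
  exists x0, A x0 /\ forall x, A x -> h x <= h x0.
Proof.
move=> [a Aa] hM hlim.
pose E : set RR := [set e | exists2 x, A x & h x = e]%classic.
have supE : has_sup E by split; [exists (h a), a | exists M => _ [x /hM hx <-]].
have : forall n : nat, exists x, A x /\ sup E - n.+1%:R^-1 <= h x.
  move=> n; have n0 : 0 < n.+1%:R^-1 :> RR by rewrite invr_gt0 ltr0n.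
  by have [_ [x Ax <-] hx] := sup_adherent n0 supE; exists x; split=> //; exact: ltW.
move=> /choice [x hx]; have [n|x0 [Ax0 hx0]] := hlim x; first by case: (hx n).
exists x0; split=> // y Ay; apply: (@le_trans _ _ (sup E)).
  by apply: sup_upper_bound => //; exists y.
by apply: hx0 => n; case: (hx n).
Qed.

Lemma clim_ex (U : set_system nat) :
  (forall (u : nat -> RR) M, (forall n, `|u n| <= M) -> exists l, ulim U u l) ->
  forall (z : nat -> CC) M, (forall n, cabs (z n) <= M) -> exists l, clim U z l.
Proof.
move=> hU z M hM.
have [a ha] := hU _ M (fun n => le_trans (Re_le_cabs (z n)) (hM n)).
have [b hb] := hU _ M (fun n => le_trans (Im_le_cabs (z n)) (hM n)).
by exists (a +i* b)%C.
Qed.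

Lemma clim_closed (U : set_system nat) (A : CC -> Prop) (z : nat -> CC) l :
  ProperFilter U ->
  (forall z, ~ A z -> exists e : RR, 0 < e /\ forall w, cabs (w - z) < e -> ~ A w) ->
  clim U z l -> (forall n, A (z n)) -> A l.
Proof.
move=> PU hA zl Az; apply: contrapT => /hA [e [e0 he]].
by have [n hn] := clim_near PU zl e0; exact: (he _ hn).
Qed.

(** * Tangent states, their transport by [p], and a maximal one *)

(** This is [Re (v / (z - u))], constant as [u <> z] runs over a circle through [z] centred on the
    line along [v]. Its value at [u = z] is 0, hence the conditions [z - u != 0] below. *)
Definition tangent_ratio (v z u : CC) : RR := dot v (z - u) / dot (z - u) (z - u).

(* For [m > 0] the last two conditions say that the frontier lies between the
   circles through [z] centred at [z - v] and at [z - v / (2 m)]. *)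
Definition tangent (K : CC -> Prop) (m : RR) (z v : CC) : Prop :=
  [/\ K z,
      forall s, K s -> 0 <= dot v (z - s),
      forall s, frontier K s -> m * dot (z - s) (z - s) <= dot v (z - s) &
      forall s, frontier K s -> dot v (z - s) <= dot (z - s) (z - s) / 2].

Section TangentStates.
Variables (p : {poly CC}) (K : CC -> Prop) (D : RR).
Hypothesis H : invariant_body p K D.
Let p2 := body_size H.
Let p1 : (1 < size p)%N := ltnW p2.
Let g := barycenter p.
Let d : RR := (size p).-1%:R.
(** Multiplication by [p'] carries an outer normal at [z] to one at [p.[z]]; the factor [1/d] turns
    the sum over a fibre into a mean. *)
Let transport z v := v * p^`().[z] / (size p).-1%:R.

Let d_gt0 : 0 < d.
Proof. by rewrite ltr0n; case: (size p) p2 => [|[]]. Qed.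

Lemma body_dist x y : K x -> K y -> dot (x - y) (x - y) <= (D + D) ^+ 2.
Proof.
move=> /(body_bounded H) hx /(body_bounded H) hy.
have h : cabs (x - y) <= D + D by have := cabsD x (- y); rewrite cabsN; lra.
rewrite -cabs_sqr ler_sqr ?nnegrE ?cabs_ge0 //.
exact: le_trans (cabs_ge0 _) h.
Qed.

Lemma fiber_body s us u : K s -> fiber p s us -> u \in us -> K u.
Proof.
move=> Ks hus; rewrite (fiber_mem _ p1 hus) => /eqP e.
by apply: (proj2 (body_invariant H u)); rewrite e.
Qed.

Lemma fiber_frontier s us u : frontier K s -> fiber p s us -> u \in us -> frontier K u.
Proof.
move=> Ks hus; rewrite (fiber_mem _ p1 hus) => /eqP e.
by apply: (frontier_preim H); rewrite e.
Qed.

Lemma fiber_dot_mean s us v z : fiber p s us ->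
  \sum_(u <- us) dot v (z - u) = d * dot v (z - g).
Proof.
move=> hus; rewrite -dot_sumr big_split /= sumrN (fiber_sum p2 hus) -/g.
have -> : \sum_(u <- us) z = d%:C%C * z.
  rewrite /d -(fiber_size p1 hus) rmorph_nat mulr_natl.
  elim: us {hus} => [|x us IH]; first by rewrite big_nil.
  by rewrite big_cons mulrS IH.
by rewrite -[(size p).-1%:R](rmorph_nat (real_complex RR)) -/d -mulrBr dotZr.
Qed.

Lemma fiber_cst_sum s us (c : RR) : fiber p s us -> \sum_(u <- us) c = c * d.
Proof.
move=> hus; rewrite /d -(fiber_size p1 hus) mulr_natr.
by elim: us {hus} => [|x us IH]; rewrite ?big_nil // big_cons mulrS IH.
Qed.

Lemma transport_ge s us z v (c : RR) : fiber p s us ->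
  c * d <= \sum_(u <- us) tangent_ratio v z u ->
  c * dot (p.[z] - s) (p.[z] - s) <= dot (transport z v) (p.[z] - s).
Proof.
move=> hus hc; have [->|zs] := eqVneq p.[z] s; first by rewrite subrr !dot0r mulr0.
rewrite (dot_transport v p2 hus zs) mulrC ler_wpM2l ?dot_ge0 //.
by rewrite ler_pdivlMr.
Qed.

Lemma transport_le s us z v (c : RR) : fiber p s us ->
  \sum_(u <- us) tangent_ratio v z u <= c * d ->
  dot (transport z v) (p.[z] - s) <= c * dot (p.[z] - s) (p.[z] - s).
Proof.
move=> hus hc; have [->|zs] := eqVneq p.[z] s; first by rewrite subrr !dot0r mulr0.
rewrite (dot_transport v p2 hus zs) mulrC ler_wpM2r ?dot_ge0 //.
by rewrite ler_pdivrMr.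
Qed.

Lemma fiber_neq s us z u : fiber p s us -> p.[z] != s -> u \in us -> z - u != 0.
Proof.
move=> hus zs; rewrite (fiber_mem _ p1 hus) subr_eq0 => /eqP e.
by apply: contra zs => /eqP ->; rewrite e.
Qed.

Lemma ratio_ge m z v u : tangent K m z v -> frontier K u -> z - u != 0 ->
  m <= tangent_ratio v z u.
Proof. by move=> [_ _ h _] hu zu; rewrite ler_pdivlMr ?dot_gt0 // h. Qed.

(** Each inequality bounds the ratios over a fibre one by one, hence their mean, which is the ratio
    of the image state. Invariance keeps the fibre in [K], and in the frontier when [s] is there. *)
Lemma tangent_transport m z v : tangent K m z v -> tangent K m p.[z] (transport z v).
Proof.
move=> ht; have [Kz h0 hm h2] := ht; split.
- exact: (proj1 (body_invariant H z)).
- move=> s Ks; have [us hus] := fiber_ex s p1.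
  rewrite -[0](mul0r (dot (p.[z] - s) (p.[z] - s))); apply: (transport_ge hus).
  rewrite mul0r big_seq sumr_ge0 // => u hu.
  by rewrite divr_ge0 ?dot_ge0 // h0 //; exact: fiber_body Ks hus hu.
- move=> s Xs; have [us hus] := fiber_ex s p1.
  have [->|zs] := eqVneq p.[z] s; first by rewrite subrr !dot0r mulr0.
  apply: (transport_ge hus); rewrite -(fiber_cst_sum _ hus) !big_seq ler_sum // => u hu.
  by apply: (ratio_ge ht); [exact: fiber_frontier Xs hus hu | exact: fiber_neq hus zs hu].
- move=> s Xs; have [us hus] := fiber_ex s p1.
  have [->|zs] := eqVneq p.[z] s; first by rewrite subrr !dot0r mul0r.
  rewrite mulrC; apply: (transport_le hus).
  rewrite -(fiber_cst_sum _ hus) !big_seq ler_sum // => u hu.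
  have n0 := dot_gt0 (fiber_neq hus zs hu).
  rewrite /tangent_ratio ler_pdivrMr // [leRHS]mulrC; apply: h2; exact: fiber_frontier Xs hus hu.
Qed.

Lemma fiber_barycenter s us c : fiber p s us -> (forall u, u \in us -> u = c) -> c = g.
Proof.
move=> hus hc; have d0 : (size p).-1%:R != 0 :> CC.
  by rewrite pnatr_eq0; case: (size p) p2 => [|[]].
apply: (mulfI d0); rewrite /g -(fiber_sum p2 hus) big_seq (eq_bigr (fun=> c)) // -big_seq.
rewrite -(fiber_size p1 hus) mulr_natl; elim: (us) => [|x s' IH]; first by rewrite big_nil.
by rewrite big_cons mulrS IH.
Qed.

(* A one-point fibre would be the barycentre, which is interior. *)
Lemma fiber_two s us : frontier K s -> fiber p s us ->
  exists u u', [/\ u \in us, u' \in us & u != u'].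
Proof.
move=> Xs hus; apply: contrapT => hn.
have sz := fiber_size p1 hus; case: us => [|c us'] in hus sz hn.
  by move: d_gt0; rewrite /d -sz ltxx.
have [_] := fiber_frontier Xs hus (mem_head c us'); apply.
rewrite (@fiber_barycenter s (c :: us') c hus); first exact: (inner_barycenter H).
move=> u hu; apply/eqP/negPn/negP => ne; apply: hn.
by exists u, c; rewrite mem_head.
Qed.

(** Two distinct points of a fibre over the frontier cannot both be [z]. *)
Lemma frontier_other z : exists2 s, frontier K s & z - s != 0.
Proof.
have [s Xs] := frontier_ex H; have [us hus] := fiber_ex s p1.
have [u [u' [hu hu' ne]]] := fiber_two Xs hus.
have [e|zu] := eqVneq z u; last first.
  by exists u; [exact: fiber_frontier Xs hus hu | rewrite subr_eq0].
by exists u'; [exact: fiber_frontier Xs hus hu' | rewrite subr_eq0 e].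
Qed.

Lemma tangent_le_half m z v : tangent K m z v -> m <= 1 / 2.
Proof.
move=> [_ _ hm h2]; have [s Xs zs] := frontier_other z.
have := hm s Xs; have := h2 s Xs; have := dot_gt0 zs; nra.
Qed.

(** Averaging the last tangency inequality over a fibre bounds [dot v (z - g)] by [(2D)^2 / 2]; the
    disc about [g] and the supporting half-plane bound it below by [r |v| / 2]. *)
Lemma tangent_normal_bound :
  exists B : RR, forall m z v, tangent K m z v -> cabs v <= B.
Proof.
have [r [r0 hr]] := inner_barycenter H; have [s Xs] := frontier_ex H.
have [us hus] := fiber_ex s p1.
exists ((D + D) ^+ 2 / r) => m z v [Kz h0 _ h2].
have h : dot v (z - g) <= (D + D) ^+ 2 / 2.
  rewrite -(ler_pM2l d_gt0) -(fiber_dot_mean _ _ hus) mulrC -(fiber_cst_sum _ hus).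
  rewrite !big_seq ler_sum // => u hu; have Xu := fiber_frontier Xs hus hu.
  by have := h2 _ Xu; have := body_dist Kz (proj1 Xu); lra.
have [->|v0] := eqVneq v 0; first by rewrite cabs0 divr_ge0 ?sqr_ge0 ?(ltW r0).
have c0 := cabs_gt0 v0.
pose t : RR := r / 2 / cabs v.
have t0 : 0 < t by rewrite !divr_gt0.
have Kt : K (g + t%:C%C * v).
  apply: hr; rewrite addrAC subrr add0r cabsM cabsC gtr0_norm // /t.
  by rewrite divfK ?gt_eqF //; lra.
have := h0 _ Kt; rewrite opprD addrA dotDr dotNr dotZr -cabs_sqr /t => h3.
have h4 : r / 2 / cabs v * cabs v ^+ 2 = r / 2 * cabs v.
  by rewrite expr2 mulrA divfK ?gt_eqF.
by rewrite ler_pdivlMr //; move: h3; rewrite h4; lra.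
Qed.

(** Used twice: with [w = 0], [a = 1] for the frontier point nearest to [g], and with [w = v],
    [a = - m] for the least slack in the lower tangency inequality. For [r > 0] the constraint keeps
    [u] away from [q]. *)
Lemma frontier_argmin q (r : RR) w (a : RR) :
  (exists u, frontier K u /\ r <= dot (q - u) (q - u)) ->
  exists u0, [/\ frontier K u0, r <= dot (q - u0) (q - u0) &
    forall u, frontier K u -> r <= dot (q - u) (q - u) ->
      dot w (q - u0) + a * dot (q - u0) (q - u0) <=
      dot w (q - u) + a * dot (q - u) (q - u)].
Proof.
move=> ex.
pose A u := frontier K u /\ r <= dot (q - u) (q - u).
(* [attained] maximises, hence the sign; the upper bound comes from Cauchy-Schwarz and
   [|q - u| <= |q| + D]. *)
pose h u := - (dot w (q - u) + a * dot (q - u) (q - u)).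
have [x|x Ax|u0 [[X0 r0] h0]] :=
  @attained CC A h (cabs w * (cabs q + D) + `|a| * (cabs q + D) ^+ 2) ex.
- move=> [[Kx _] _].
  have hq : cabs (q - x) <= cabs q + D.
    by have := cabsD q (- x); rewrite cabsN; have := body_bounded H Kx; lra.
  rewrite /h opprD -mulNr; apply: lerD.
    rewrite -dotNr (le_trans (dot_le_cabs _ _)) // cabsN ler_wpM2l ?cabs_ge0 //.
  rewrite -cabs_sqr; apply: (@le_trans _ _ (`|a| * cabs (q - x) ^+ 2)).
    by rewrite ler_wpM2r ?sqr_ge0 // -normrN ler_norm.
  rewrite ler_wpM2l // ler_sqr ?nnegrE ?cabs_ge0 //.
  exact: le_trans (cabs_ge0 _) hq.
- have [U [PU [U_oo hU]]] := ultralimits RR.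
  have [l xl] := clim_ex hU (fun n => body_bounded H (proj1 (proj1 (Ax n)))).
  have ql := climB PU (clim_cst PU q) xl.
  exists l; split; first split.
  + exact: (clim_closed PU (frontier_closed H) xl (fun n => proj1 (Ax n))).
  + exact: (ulim_le PU (ulim_cst PU (a := r)) (ulim_dot PU ql ql) (fun n => proj2 (Ax n))).
  + move=> b hb; have hh : ulim U (fun n => h (x n)) (h l).
      rewrite /h -[X in ulim _ _ X]add0r; under [X in ulim _ X]eq_fun do rewrite -sub0r.
      apply: ulimB; first exact: ulim_cst.
      apply: ulimD; first by apply: ulim_dot => //; exact: clim_cst.
      by apply: ulimM; [exact: ulim_cst | exact: ulim_dot].
    exact: (ulim_harmonic PU U_oo hh hb).
by exists u0; split=> // u Xu ru; have := h0 u (conj Xu ru); rewrite /h lerN2.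
Qed.

(** The homothety with centre [s] and ratio [t] sends the disc of radius [r] about [y] to a disc of
    radius [t * r] inside [K]. *)
Lemma inner_convex y s (t : RR) : inner K y -> K s -> 0 < t -> t <= 1 ->
  inner K (t%:C%C * y + (1 - t)%:C%C * s).
Proof.
move=> [r [r0 hr]] Ks t0 t1; exists (t * r); split=> [|x hx]; first exact: mulr_gt0.
set z := (t%:C%C * y + _) in hx.
have tC : t%:C%C != 0 :> CC by rewrite (fmorph_eq0 (real_complex RR)) gt_eqF.
have Ky : K (y + (x - z) / t%:C%C).
  apply: hr; rewrite addrAC subrr add0r cabsM.
  rewrite -(fmorphV (real_complex RR)) cabsC ger0_norm ?invr_ge0 ?(ltW t0) //.
  rewrite ltr_pdivrMr // [r * t]mulrC; exact: hx.
have := body_convex H Ky Ks (ltW t0) t1; congr K.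
by rewrite mulrDr mulrCA divff // mulr1 addrAC -/z addrC subrK.
Qed.

(* The largest disc about the barycentre contained in [K] touches the frontier
   at [z]. *)
Lemma tangent_ex : exists m z v, 0 < m /\ tangent K m z v.
Proof.
have [x Xx] := frontier_ex H.
have [z [Xz _ hz]] : exists u0, [/\ frontier K u0, 0 <= dot (g - u0) (g - u0) &
    forall u, frontier K u -> 0 <= dot (g - u) (g - u) ->
      dot 0 (g - u0) + 1 * dot (g - u0) (g - u0) <= dot 0 (g - u) + 1 * dot (g - u) (g - u)].
  by apply: frontier_argmin; exists x; rewrite dot_ge0.
pose v := z - g.
have v0 : v != 0.
  rewrite subr_eq0; apply/eqP => e; have [_] := Xz; apply; rewrite e.
  exact: (inner_barycenter H).
have {}hz u : frontier K u -> dot v v <= dot (g - u) (g - u).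
  move=> Xu; have := hz u Xu (dot_ge0 _); rewrite !dot0l !mul1r !add0r.
  by rewrite /v -opprB dotNl dotNr opprK.
(* If [y] were outside, the segment from [g] to [y] would contain a frontier point nearer to [g]
   than [z]. *)
have disc y : dot (g - y) (g - y) < dot v v -> K y.
  move=> hy; apply: contrapT => nKy.
  have [t [t0 t1 Xt]] := frontier_segment H (innerW (inner_barycenter H)) nKy.
  have := hz _ Xt; rewrite opprD addrA subrr add0r -mulrN opprB -/g dotZl dotZr.
  have t2 : t * t <= 1 by nra.
  have n0 := dot_ge0 (g - y); have := ler_wpM2r n0 t2; rewrite mulrA; lra.
have disc_inner y : cabs (y - g) < cabs v -> inner K y.
  move=> hy; exists (cabs v - cabs (y - g)); rewrite subr_gt0; split=> // w hw.
  apply: disc; rewrite -!cabs_sqr ltr_sqr ?nnegrE ?cabs_ge0 // cabsB.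
  by have := cabs_triangle y w g; lra.
have Kz := proj1 Xz.
(* At [z] itself the parameter 0 is enough: the upper bound is [|g - s| >= |g - z|] expanded, the
   rest is the supporting line [h0]. *)
have T0 : tangent K 0 z v.
  have h0 s : K s -> 0 <= dot v (z - s).
    (* If [s] were beyond the tangent line, a small step from [z] away from [s] would enter the open
       disc, and [z] would lie between an inner point and [s], hence be inner. *)
    move=> Ks; rewrite leNgt; apply/negP => hs; have [_] := Xz; apply.
    set w := z - s in hs.
    have ww := dot_ge0 w; have w1 : 0 < dot w w + 1 by lra.
    (* This [k] gives [k |w|^2 < - 2 dot v w], so [z + k w] is nearer to [g] than [z]; the added 1
       keeps the denominator positive. *)
    have [k [k0 kE]] : exists k : RR, 0 < k /\ k * (dot w w + 1) = - dot v w.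
      exists (- dot v w / (dot w w + 1)).
      by rewrite divr_gt0 ?oppr_gt0 // divfK // gt_eqF.
    have iy : inner K (z + k%:C%C * w).
      apply: disc_inner; rewrite -ltr_sqr ?nnegrE ?cabs_ge0 // !cabs_sqr.
      have -> : z + k%:C%C * w - g = v + k%:C%C * w by rewrite /v addrAC.
      rewrite dot_sqrD !dotZl !dotZr; nra.
    have k1 : 0 < 1 + k by lra.
    have t0 : 0 < (1 + k)^-1 by rewrite invr_gt0.
    have t1 : (1 + k)^-1 <= 1 by rewrite invf_le1 //; lra.
    have := inner_convex iy Ks t0 t1; congr (inner K).
    have -> : 1 - (1 + k)^-1 = k / (1 + k) by field; rewrite gt_eqF.
    have kC : 1 + k%:C%C != 0 :> CC.
      by rewrite -(rmorph1 (real_complex RR)) -rmorphD fmorph_eq0 gt_eqF.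
    rewrite rmorphM !(fmorphV (real_complex RR)) !(rmorphD (real_complex RR)) /=.
    rewrite (rmorph1 (real_complex RR)) /w; field.
    exact: kC.
  split=> // s Xs; first by rewrite mul0r h0 //; case: Xs.
  have := hz s Xs; have -> : g - s = (z - s) - v by rewrite /v; ring.
  rewrite (dot_sqrB (z - s) v); lra.
have vv := dot_gt0 v0.
pose C := (D + D) ^+ 2 + 1; have C0 : 0 < C by rewrite ltr_wpDl ?sqr_ge0.
(* After one step the ratios, with nonnegative numerators of mean [dot v (z - g) = |v|^2] and
   denominators at most [C], have mean at least [|v|^2 / C]. *)
exists (dot v v / C), p.[z], (transport z v); split; first exact: divr_gt0.
have [T1 T2 _ T4] := tangent_transport T0; split=> // s Xs.
have [us hus] := fiber_ex s p1.
have [->|zs] := eqVneq p.[z] s; first by rewrite subrr !dot0r mulr0.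
apply: (transport_ge hus).
rewrite mulrAC mulrC [dot v v * d]mulrC -(fiber_dot_mean _ _ hus) mulr_sumr !big_seq.
apply: ler_sum => u hu; have Ku := proj1 (fiber_frontier Xs hus hu).
have zu := fiber_neq hus zs hu; have n0 := dot_gt0 zu.
rewrite /tangent_ratio mulrC ler_wpM2l //; first by case: T0 => _ h _ _; exact: h.
by rewrite lef_pV2 ?posrE // /C; have := body_dist Kz Ku; lra.
Qed.

(** States with [m >= 0] form a compact set: [m <= 1 / 2], [z] is in [K], [v] is bounded, and all
    conditions pass to limits. Negative parameters cannot exceed the positive one from
    [tangent_ex]. *)
Lemma tangent_max : exists m z v, [/\ 0 < m, tangent K m z v &
  forall m' z' v', tangent K m' z' v' -> m' <= m].
Proof.
have [m0 [z0 [v0 [m0_gt0 T0]]]] := tangent_ex.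
have [B hB] := tangent_normal_bound.
pose A (x : RR * CC * CC) := 0 <= x.1.1 /\ tangent K x.1.1 x.1.2 x.2.
have exA : exists x, A x by exists (m0, z0, v0); split=> //; exact: ltW.
have [[[m z] v] [_ Tx]|x Ax|[[m z] v] [[m_ge0 T] hmax]] :=
  @attained _ A (fun x => x.1.1) (1 / 2) exA.
- exact: tangent_le_half Tx.
- have [U [PU [U_oo hU]]] := ultralimits RR.
  have K_ n : K (x n).1.2 by case: (Ax n) => _ [].
  have [l zl] := clim_ex hU (fun n => body_bounded H (K_ n)).
  have [v vl] := clim_ex hU (fun n => hB _ _ _ (proj2 (Ax n))).
  have [|m ml] := hU (fun n => (x n).1.1) (1 / 2).
    by move=> n; have [n0 /tangent_le_half] := Ax n; rewrite ger0_norm.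
  exists (m, l, v); split; last by move=> b hb; exact: (ulim_harmonic PU U_oo ml hb).
  have sl s : clim U (fun n => (x n).1.2 - s) (l - s) by apply: (climB PU) => //; exact: clim_cst.
  split=> /=; first exact: (ulim_le PU (ulim_cst PU (a := 0)) ml (fun n => proj1 (Ax n))).
  split=> [|s Ks|s Xs|s Xs].
  + exact: (clim_closed PU (body_closed H) zl K_).
  + apply: (ulim_le PU (ulim_cst PU (a := 0)) (ulim_dot PU vl (sl s))) => n.
    by case: (Ax n) => _ [_ h _ _]; exact: h.
  + apply: (ulim_le PU (ulimM PU ml (ulim_dot PU (sl s) (sl s))) (ulim_dot PU vl (sl s))) => n.
    by case: (Ax n) => _ [_ _ h _]; exact: h.
  + apply: (ulim_le PU (ulim_dot PU vl (sl s))
             (ulimM PU (ulim_dot PU (sl s) (sl s)) (ulim_cst PU (a := 2^-1)))) => n.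
    by case: (Ax n) => _ [_ _ _ h]; exact: h.
exists m, z, v; split=> //.
  by have := hmax (m0, z0, v0) (conj (ltW m0_gt0) T0) => /= /(lt_le_trans m0_gt0).
move=> m' z' v' T'; have [m'0|] := lerP 0 m'; first exact: (hmax (m', z', v') (conj m'0 T')).
by move=> h; rewrite (le_trans (ltW h)).
Qed.

End TangentStates.

(** * Means, intersections of circles, and polynomials with all roots on a circle *)

Lemma seq_mean_le (T : eqType) (us : seq T) (f : T -> RR) (c : RR) : us != [::] ->
  (size us)%:R * c <= \sum_(u <- us) f u -> exists2 u, u \in us & c <= f u.
Proof.
elim: us => // x us IH _; rewrite big_cons /= => h.
case: (lerP c (f x)) => [hx|hx]; first by exists x; rewrite ?mem_head.
have [us0|us0] := eqVneq us [::].
  by move: h hx; rewrite us0 big_nil mul1r addr0 => h /(le_lt_trans h); rewrite ltxx.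
have [|u hu hc] := IH us0; last by exists u; rewrite // in_cons hu orbT.
by move: h; rewrite -natr1 mulrDl mul1r; lra.
Qed.

Definition cross (w k : CC) : RR := Re w * Im k - Im w * Re k.

(** Orthogonality to [w] makes [x] a real multiple of [i w]; the second equation puts it on the
    circle about [k] through 0, which meets that line in at most one further point, so the multiple
    is forced. *)
Lemma chord_determined (w k x : CC) : w != 0 -> x != 0 ->
  dot w x = 0 -> dot x x = 2 * dot x k ->
  dot w w * Re x = - (2 * cross w k) * Im w /\
  dot w w * Im x = 2 * cross w k * Re w.
Proof.
move=> w0 x0 xw xx; pose c := cross w x.
have x1 : dot w w * Re x = - c * Im w.
  by rewrite -[RHS]addr0 -(mulr0 (Re w)) -xw /c /cross /dot; ring.
have x2 : dot w w * Im x = c * Re w.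
  by rewrite -[RHS]addr0 -(mulr0 (Im w)) -xw /c /cross /dot; ring.
have cc : c * c = 2 * (c * cross w k).
  transitivity (dot w w * dot x x).
    by rewrite -[LHS]addr0 -(mulr0 (dot w x)) -xw /c /cross /dot; ring.
  rewrite xx; transitivity (2 * ((dot w w * Re x) * Re k + (dot w w * Im x) * Im k)).
    by rewrite /dot; ring.
  by rewrite x1 x2 /cross /dot; ring.
have ww : dot w w != 0 by rewrite gt_eqF ?dot_gt0.
have c0 : c != 0.
  apply: contra x0 => /eqP c0; apply/eqP; apply: complex_ext; apply: (mulfI ww).
    by rewrite x1 c0 oppr0 mul0r mulr0.
  by rewrite x2 c0 mul0r mulr0.
have cE : c = 2 * cross w k by apply: (mulfI c0); rewrite cc; ring.
by rewrite -cE.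
Qed.

(** If [a != b], both [e2 - e1] and [e3 - e1] are orthogonal to [a - b] and lie on one circle
    through 0, so they coincide. *)
Lemma circumcenter_uniq (a b e1 e2 e3 : CC) (r s : RR) :
  e1 != e2 -> e1 != e3 -> e2 != e3 ->
  (forall e, e \in [:: e1; e2; e3] -> dot (e - a) (e - a) = r /\ dot (e - b) (e - b) = s) ->
  a = b.
Proof.
move=> n12 n13 n23 h.
have [a1 b1] : dot (e1 - a) (e1 - a) = r /\ dot (e1 - b) (e1 - b) = s.
  by apply: h; rewrite mem_head.
apply/eqP; rewrite -subr_eq0; apply/negPn/negP => w0.
have key e : e != e1 -> e \in [:: e1; e2; e3] ->
    dot (a - b) (a - b) * Re (e - e1) = - (2 * cross (a - b) (a - e1)) * Im (a - b) /\
    dot (a - b) (a - b) * Im (e - e1) = 2 * cross (a - b) (a - e1) * Re (a - b).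
  move=> ne /h[ha hb]; apply: (chord_determined w0); first by rewrite subr_eq0.
    move: ha hb; rewrite -a1 -b1.
    have -> : dot (e - b) (e - b) =
        dot (e - a) (e - a) + 2 * dot (a - b) (e - a) + dot (a - b) (a - b).
      by rewrite /dot !ReImE; ring.
    have -> : dot (e1 - b) (e1 - b) =
        dot (e1 - a) (e1 - a) + 2 * dot (a - b) (e1 - a) + dot (a - b) (a - b).
      by rewrite /dot !ReImE; ring.
    have -> : dot (a - b) (e - e1) = dot (a - b) (e - a) - dot (a - b) (e1 - a).
      by rewrite /dot !ReImE; ring.
    by lra.
  move: ha; rewrite -a1.
  have -> : dot (e - a) (e - a) =
      dot (e - e1) (e - e1) - 2 * dot (e - e1) (a - e1) + dot (e1 - a) (e1 - a).
    by rewrite /dot !ReImE; ring.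
  by lra.
have ww : dot (a - b) (a - b) != 0 by rewrite gt_eqF ?dot_gt0.
have [||r2 i2] := key e2; rewrite ?inE ?eqxx ?orbT //; first by rewrite eq_sym.
have [||r3 i3] := key e3; rewrite ?inE ?eqxx ?orbT //; first by rewrite eq_sym.
case/eqP: n23; apply: (addIr (- e1)); apply: complex_ext; apply: (mulfI ww).
  by rewrite r2 r3.
by rewrite i2 i3.
Qed.

(* A polynomial with all its roots on a circle about the origin is
   self-inversive. *)
Lemma self_inversive (ws : seq CC) (r : CC) (i j : nat) :
  (forall w, w \in ws -> w * w^* = r) -> (i + j = size ws)%N ->
  ((\prod_(w <- ws) ('X - w%:P))`_j)^* * r ^+ j =
  (\prod_(w <- ws) - w^*) * (\prod_(w <- ws) ('X - w%:P))`_i.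
Proof.
elim: ws i j => [|w ws IH] i j hr.
  case: i j => [|i] [|j] //= _.
  by rewrite !big_nil expr0 coef1 eqxx conjC1.
have {}IH i' j' := IH i' j' (fun x hx => hr x (mem_behead (s := w :: ws) hx)).
have wr := hr w (mem_head _ _).
set Q := \prod_(x <- ws) ('X - x%:P) in IH *; set l := \prod_(x <- ws) - x^* in IH *.
have szQ : size Q = (size ws).+1 by rewrite size_prod_XsubC.
rewrite !big_cons -/Q -/l !mulrBl !coefB !coefXM !coefCM /=.
(* When one index is 0, the other exceeds the degree of [Q], so its coefficient there is 0. *)
case: i j => [|i] [|j] //= hij.
- have -> : Q`_j.+1 = 0 by rewrite nth_default // szQ; lia.
  have := IH 0%N j; rewrite add0n => /(_ ltac:(lia)) h.
  rewrite mulr0 subr0 sub0r exprSr mulrA h -wr; ring.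
- have -> : Q`_i.+1 = 0 by rewrite nth_default // szQ; lia.
  have := IH i 0%N; rewrite addn0 => /(_ ltac:(lia)) h.
  rewrite mulr0 subr0 sub0r rmorphN rmorphM /= expr0 mulr1.
  by move: h; rewrite expr0 mulr1 => ->; ring.
- have h1 := IH i.+1 j ltac:(lia); have h2 := IH i j.+1 ltac:(lia).
  rewrite rmorphB rmorphM /=.
  transitivity ((Q`_j)^* * r ^+ j * r - w^* * ((Q`_j.+1)^* * r ^+ j.+1)).
    by rewrite exprSr; ring.
  by rewrite h1 h2 -wr; ring.
Qed.

Lemma conjC_mulE (w : CC) : w * w^* = (dot w w)%:C%C.
Proof. by apply: complex_ext; case: w => a b; rewrite /dot /=; ring. Qed.

(* Comparing the self-inversive relations of [p - e] and [p - e'] kills every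
   coefficient strictly between the constant and the leading one. *)
Lemma two_circle_fibers (p : {poly CC}) (e e' c : CC) (r : RR) :
  (1 < size p)%N -> e != e' ->
  (forall u, p.[u] = e \/ p.[u] = e' -> dot (u - c) (u - c) = r) ->
  exists q, forall z, p.[z] = lead_coef p * (z - c) ^+ (size p).-1 + q.
Proof.
move=> p1 ne h; pose P := p \Po ('X + c%:P).
set d := (size p).-1; set a := lead_coef p.
have a0 : a != 0 by exact: lead_coef_neq0.
have coefE s : s = e \/ s = e' -> forall i j, (i + j = d)%N -> (0 < i)%N -> (0 < j)%N ->
    a * (P`_j)^* * r%:C%C ^+ j = (P`_0 - s)^* * P`_i.
  move=> hs; have [us hus] := fiber_ex s p1.
  pose ws := [seq u - c | u <- us].
  have szw : size ws = d by rewrite size_map (fiber_size p1 hus).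
  have PE : P - s%:P = a *: \prod_(w <- ws) ('X - w%:P).
    have -> : P - s%:P = (p - s%:P) \Po ('X + c%:P) by rewrite comp_polyB comp_polyC.
    rewrite hus comp_polyZ rmorph_prod /= big_map; congr (_ *: _); apply: eq_bigr => u _.
    by rewrite comp_polyB comp_polyX comp_polyC polyCB; ring.
  have hr w : w \in ws -> w * w^* = r%:C%C.
    move=> /mapP[u hu ->]; rewrite conjC_mulE h //.
    by move: hu; rewrite (fiber_mem _ p1 hus) => /eqP ->.
  have hP k : (0 < k)%N -> P`_k = a * (\prod_(w <- ws) ('X - w%:P))`_k.
    move=> k0; have := congr1 (fun Q : {poly CC} => Q`_k) PE.
    by rewrite coefB coefC coefZ gtn_eqF // subr0.
  have P0 : P`_0 - s = a * (\prod_(w <- ws) ('X - w%:P))`_0.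
    by have := congr1 (fun Q : {poly CC} => Q`_0) PE; rewrite coefB coefC coefZ.
  move=> i j hij i0 j0; rewrite (hP j) // (hP i) // P0 !rmorphM /=.
  have h1 := self_inversive (i := i) (j := j) hr ltac:(by rewrite szw).
  (* The pair [(d, 0)] identifies the product of the [- w^*] as the conjugate of the constant
     coefficient. *)
  have := self_inversive (i := d) (j := 0%N) hr ltac:(by rewrite szw addn0).
  have -> : (\prod_(w <- ws) ('X - w%:P))`_d = 1.
    rewrite -szw -[size ws]/((size ws).+1.-1) -(size_prod_XsubC ws id).
    exact/monicP/monic_prod_XsubC.
  rewrite expr0 !mulr1 => h0.
  transitivity (a * a^* * (((\prod_(w <- ws) ('X - w%:P))`_j)^* * r%:C%C ^+ j)); first ring.
  rewrite h1 h0; ring.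
have Pz i : (0 < i)%N -> (i < d)%N -> P`_i = 0.
  move=> i0 id; have ij : (i + (d - i) = d)%N by rewrite subnKC // ltnW.
  have j0 : (0 < d - i)%N by rewrite subn_gt0.
  have h1 := coefE e (or_introl erefl) _ _ ij i0 j0.
  have h2 := coefE e' (or_intror erefl) _ _ ij i0 j0.
  move: h2; rewrite h1 => /eqP; rewrite -subr_eq0 -mulrBl mulf_eq0 => /orP[|/eqP //].
  by rewrite -rmorphB conjC_eq0 opprB addrC subrKA subr_eq0 eq_sym (negPf ne).
exists P`_0 => z.
have szP : size P = d.+1.
  rewrite size_comp_poly2 ?size_XaddC // /d prednK //; exact: ltnW.
have lP : P`_d = a.
  have : lead_coef P = a * lead_coef ('X + c%:P) ^+ d by rewrite lead_coef_comp // size_XaddC.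
  by rewrite lead_coefXaddC expr1n mulr1 lead_coefE szP.
have -> : p.[z] = P.[z - c] by rewrite horner_comp hornerD hornerX hornerC subrK.
rewrite horner_coef szP big_ord_recr /= lP addrC; congr (_ + _).
have d0 : (0 < d)%N by rewrite /d -subn1 subn_gt0.
clear coefE szP lP; case: d d0 Pz => // d' _ Pz.
rewrite big_ord_recl /= expr0 mulr1 big1 ?addr0 // => i _.
by rewrite Pz ?mul0r // /bump /= add1n ltnS.
Qed.

(** * Contact points of a maximal tangent state *)

(** Equality in the lower tangency bound puts [e] on the outer circle. *)
Definition contact (K : CC -> Prop) (m : RR) (z v e : CC) : Prop :=
  [/\ frontier K e, z - e != 0 & dot v (z - e) = m * dot (z - e) (z - e)].

Section ExtremalTangent.
Variables (p : {poly CC}) (K : CC -> Prop) (D m : RR).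
Hypothesis H : invariant_body p K D.
Hypothesis m_gt0 : 0 < m.
Hypothesis m_max : forall m' z v, tangent K m' z v -> m' <= m.
Let p2 := body_size H.
Let p1 : (1 < size p)%N := ltnW p2.
Let g := barycenter p.
Let d : RR := (size p).-1%:R.
Let transport z v := v * p^`().[z] / (size p).-1%:R.
(** The centre of the outer circle, whose radius is [|v| / (2m)]. *)
Let centre z v : CC := z - (2 * m)^-1%:C%C * v.

Let d_gt0 : 0 < d.
Proof. by rewrite ltr0n; case: (size p) p2 => [|[]]. Qed.

(** A supporting line with nonzero normal cannot pass through an inner point, and [m > 0] with a
    second frontier point rules out [v = 0]. *)
Lemma tangent_neq_barycenter z v : tangent K m z v -> z - g != 0.
Proof.
move=> [Kz h0 hm _]; apply/eqP => /eqP; rewrite subr_eq0 => /eqP zg.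
have [s Xs zs] := frontier_other H z.
have v0 : v != 0.
  apply/eqP => v0; have := hm s Xs; rewrite v0 dot0l leNgt => /negP; apply.
  by rewrite mulr_gt0 ?dot_gt0.
have [r [r0 hr]] := inner_barycenter H; have c0 := cabs_gt0 v0.
pose t : RR := r / 2 / cabs v.
have t0 : 0 < t by rewrite !divr_gt0.
have Kt : K (g + t%:C%C * v).
  apply: hr; rewrite addrAC subrr add0r cabsM cabsC gtr0_norm // /t.
  by rewrite divfK ?gt_eqF //; lra.
have := h0 _ Kt; rewrite zg opprD addrA subrr add0r dotNr dotZr oppr_ge0 leNgt => /negP; apply.
by rewrite mulr_gt0 ?dot_gt0.
Qed.

(** As [g] is the mean of the fibre, some [u] has [dot (z - g) (z - u) >= |z - g|^2], so it is no
    nearer to [z] than [g] is. *)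
Lemma fiber_far s us z : fiber p s us ->
  exists2 u, u \in us & dot (z - g) (z - g) <= dot (z - u) (z - u).
Proof.
move=> hus; have sz := fiber_size p1 hus.
have [||u hu h] := @seq_mean_le _ us (fun u => dot (z - g) (z - u)) (dot (z - g) (z - g)).
- by rewrite -size_eq0 sz -lt0n -(ltr0n RR).
- by rewrite (fiber_dot_mean H _ _ hus) sz.
exists u => //; have := dot_ge0 ((z - g) - (z - u)); rewrite (dot_sqrB (z - g)).
rewrite (dotC (z - u)); lra.
Qed.

(** Without contact, compactness gives a slack [eta > 0] in the lower bound on all frontier points
    at distance at least [|z - g|] from [z]. Every fibre over the frontier has such a point, so the
    image state is tangent with a larger parameter, against maximality. *)
Lemma contact_ex z v : tangent K m z v -> exists e, contact K m z v e.
Proof.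
move=> T; apply: contrapT => hn; have [Kz _ hm _] := T.
have zg := dot_gt0 (tangent_neq_barycenter T).
have [s0 Xs0] := frontier_ex H.
have [|u0 [X0 r0 hmin]] := @frontier_argmin p K D H z (dot (z - g) (z - g)) v (- m).
  have [us hus] := fiber_ex s0 p1; have [u hu far] := fiber_far z hus.
  by exists u; split=> //; exact: (fiber_frontier H Xs0 hus hu).
pose eta := dot v (z - u0) - m * dot (z - u0) (z - u0).
have eta0 : 0 < eta.
  rewrite lt_neqAle subr_ge0 hm // andbT eq_sym subr_eq0; apply/eqP => e.
  apply: hn; exists u0; split=> //; apply/eqP => u00.
  by move: r0 zg; rewrite u00 dot0l => h1 h2; move: (lt_le_trans h2 h1); rewrite ltxx.
pose C := (D + D) ^+ 2 + 1; have C0 : 0 < C by rewrite ltr_wpDl ?sqr_ge0.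
have far u : frontier K u -> dot (z - g) (z - g) <= dot (z - u) (z - u) ->
    m + eta / C <= tangent_ratio v z u.
  move=> Xu hu; have := hmin u Xu hu; rewrite !mulNr -/eta => h.
  have n0 := lt_le_trans zg hu; rewrite /tangent_ratio ler_pdivlMr // mulrDl.
  have h1 : eta / C * dot (z - u) (z - u) <= eta.
    rewrite mulrAC ler_pdivrMr // ler_pM2l //.
    by have := body_dist H Kz (proj1 Xu); rewrite /C; lra.
  by lra.
(* One point of the fibre gains at least [eta / C] over [m] and the others are at least [m], so the
   mean over [d] points gains [eta / C / d]. *)
suff T' : tangent K (m + eta / C / d) p.[z] (transport z v).
  have := m_max T'; rewrite gerDl leNgt => /negP; apply.
  by rewrite !divr_gt0.
have [T1 T2 _ T4] := tangent_transport H T; split=> // s Xs.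
have [us hus] := fiber_ex s p1.
have [->|zs] := eqVneq p.[z] s; first by rewrite subrr !dot0r mulr0.
apply: (transport_ge H hus); rewrite mulrDl divfK ?gt_eqF //.
have [u hu hfar] := fiber_far z hus.
rewrite -(fiber_cst_sum H _ hus) -lerBrDl -sumrB (big_rem u hu) /=.
have h1 := far u (fiber_frontier H Xs hus hu) hfar.
rewrite -[leLHS]addr0 lerD //; first lra.
rewrite big_seq sumr_ge0 // => u' /mem_rem hu'; rewrite subr_ge0.
by apply: (ratio_ge T); [exact: (fiber_frontier H Xs hus) | exact: (fiber_neq H hus zs)].
Qed.

(** The ratios over the fibre have mean [m] and each is at least [m], so all equal [m]. *)
Lemma contact_fiber z v e us u : tangent K m z v ->
  contact K m p.[z] (transport z v) e -> fiber p e us -> u \in us -> contact K m z v u.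
Proof.
move=> T [Xe ze he] hus hu; have zs : p.[z] != e by rewrite -subr_eq0.
have Xu := fiber_frontier H Xe hus hu; have zu := fiber_neq H hus zs hu.
have nz := dot_gt0 ze.
move: he; rewrite (dot_transport v p2 hus zs) [RHS]mulrC -/d => he.
have {}he : (\sum_(u <- us) dot v (z - u) / dot (z - u) (z - u)) / d = m.
  by apply: (mulfI (negbT (gt_eqF nz))).
have hs : \sum_(u' <- us) (tangent_ratio v z u' - m) = 0.
  by rewrite sumrB (fiber_cst_sum H _ hus) -he divfK ?subrr // gt_eqF.
split=> //.
have : tangent_ratio v z u - m = 0.
  move/eqP: hs; rewrite big_seq psumr_eq0 => [|u' hu']; last first.
    rewrite subr_ge0; apply: (ratio_ge T); first exact: (fiber_frontier H Xe hus).
    exact: (fiber_neq H hus zs).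
  by move=> /allP /(_ u hu); rewrite hu => /eqP.
move/eqP; rewrite subr_eq0 => /eqP <-; rewrite /tangent_ratio divfK // gt_eqF //.
exact: dot_gt0.
Qed.

Lemma contact_circle z v e : contact K m z v e ->
  dot (e - centre z v) (e - centre z v) = dot v v / (2 * m) ^+ 2.
Proof.
move=> [_ _ he]; have -> : e - centre z v = (2 * m)^-1%:C%C * v - (z - e).
  by rewrite /centre; ring.
rewrite dot_sqrB !dotZl !dotZr (dotC (z - e)) he; field.
by rewrite gt_eqF.
Qed.

Lemma contact_two z v : tangent K m z v ->
  exists e e', [/\ contact K m z v e, contact K m z v e' & e != e'].
Proof.
move=> T; have [e he] := contact_ex (tangent_transport H T).
have [us hus] := fiber_ex e p1; have [Xe _ _] := he.
have [u [u' [hu hu' ne]]] := fiber_two H Xe hus.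
by exists u, u'; split=> //; exact: (contact_fiber T he hus).
Qed.

(** Two points come from the fibre over [e]; the third has image [e'], so it differs from both. *)
Lemma contact_three z v : tangent K m z v -> exists e1 e2 e3,
  [/\ e1 != e2, e1 != e3, e2 != e3 &
      forall e, e \in [:: e1; e2; e3] -> contact K m z v e].
Proof.
move=> T; have [e [e' [he he' ne]]] := contact_two (tangent_transport H T).
have [us hus] := fiber_ex e p1; have [us' hus'] := fiber_ex e' p1.
have [Xe _ _] := he; have [Xe' _ _] := he'.
have [u [w [hu hw uw]]] := fiber_two H Xe hus.
have [u' [_ [hu' _ _]]] := fiber_two H Xe' hus'.
have pe x : x \in us -> p.[x] = e by rewrite (fiber_mem _ p1 hus) => /eqP.
have pu' : p.[u'] = e' by move: hu'; rewrite (fiber_mem _ p1 hus') => /eqP.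
exists u, w, u'; split=> //.
- by apply: contra ne => /eqP h; rewrite -(pe u hu) -pu' h.
- by apply: contra ne => /eqP h; rewrite -(pe w hw) -pu' h.
move=> x; rewrite !inE => /or3P[] /eqP ->.
- exact: (contact_fiber T he hus).
- exact: (contact_fiber T he hus).
- exact: (contact_fiber T he' hus').
Qed.

(** All preimages of two contact points of the image state lie on the outer circle, so
    [two_circle_fibers] applies. The fibre over [q] is then the centre alone, which is therefore the
    barycentre. *)
Lemma contact_centre z v : tangent K m z v -> centre z v = g /\
  exists q, forall x, p.[x] = lead_coef p * (x - g) ^+ (size p).-1 + q.
Proof.
move=> T; have [e [e' [he he' ne]]] := contact_two (tangent_transport H T).
have hc u : p.[u] = e \/ p.[u] = e' ->
    dot (u - centre z v) (u - centre z v) = dot v v / (2 * m) ^+ 2.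
  case=> [pu|pu]; apply: contact_circle.
    have [us hus] := fiber_ex e p1; apply: (contact_fiber T he hus).
    by rewrite (fiber_mem _ p1 hus) pu.
  have [us hus] := fiber_ex e' p1; apply: (contact_fiber T he' hus).
  by rewrite (fiber_mem _ p1 hus) pu.
have [q hq] := two_circle_fibers p1 ne hc.
have cg : centre z v = g.
  have [us hus] := fiber_ex q p1; apply: (fiber_barycenter H hus) => u.
  rewrite (fiber_mem _ p1 hus) hq -subr_eq0 addrK mulf_eq0 (negPf (lead_coef_neq0 p1)) /=.
  by rewrite expf_eq0 subr_eq0 => /andP[_ /eqP].
by split=> //; exists q; rewrite -cg.
Qed.

(** Contact points of the image state lie on its outer circle, centred at [g]. Being images of
    contact points of [(z, v)], they also lie on a circle about [q], and three of them force
    [q = g]. *)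
Lemma horner_extremal z v x : tangent K m z v ->
  p.[x] = lead_coef p * (x - g) ^+ (size p).-1 + g.
Proof.
move=> T; have T' := tangent_transport H T.
have [cg [q hq]] := contact_centre T; have [cg' _] := contact_centre T'.
suff gq : g = q by rewrite hq -gq.
have [e1 [e2 [e3 [n12 n13 n23 he]]]] := contact_three T'.
(* Radius of the outer circle of [(z, v)]; [p] maps that circle into the circle of radius
   [|a| rho^d] about [q]. *)
pose rho : RR := Num.sqrt (dot v v / (2 * m) ^+ 2).
apply: (circumcenter_uniq n12 n13 n23 (r := dot (transport z v) (transport z v) / (2 * m) ^+ 2)
         (s := (cabs (lead_coef p) * rho ^+ (size p).-1) ^+ 2)) => e /he ce; split.
  by rewrite -cg'; exact: contact_circle ce.
have [us hus] := fiber_ex e p1; have [Xe _ _] := ce.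
have [u [_ [hu _ _]]] := fiber_two H Xe hus.
have := contact_circle (contact_fiber T ce hus hu); rewrite cg -cabs_sqr => cu.
move: hu; rewrite (fiber_mem _ p1 hus) => /eqP <-; rewrite hq addrK.
by rewrite -cabs_sqr cabsM cabsX /rho -cu sqrtr_sqr ger0_norm ?cabs_ge0.
Qed.

End ExtremalTangent.

Lemma horner_invariant_body (p : {poly CC}) (K : CC -> Prop) (D : RR) (x : CC) :
  invariant_body p K D ->
  p.[x] = lead_coef p * (x - barycenter p) ^+ (size p).-1 + barycenter p.
Proof.
move=> H; have [m [z [v [m0 T hmax]]]] := tangent_max H.
exact: (horner_extremal H m0 hmax x T).
Qed.

(** * Convex hulls, escape to infinity, and the filled-in Julia set *)

Lemma conv_convex (X : CC -> Prop) (x y : CC) (t : RR) :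
  conv X x -> conv X y -> 0 <= t -> t <= 1 -> conv X (t%:C%C * x + (1 - t)%:C%C * y).
Proof.
move=> [n [a [u [Xa [u0 [u1 ->]]]]]] [k [b [w [Xb [w0 [w1 ->]]]]]] t0 t1.
exists (n + k)%N, (fun i => match split i with inl i => a i | inr i => b i end),
  (fun i => match split i with inl i => t * u i | inr i => (1 - t) * w i end).
split; first by move=> i; case: split.
split; first by move=> i; case: split => j; rewrite mulr_ge0 // subr_ge0.
have lE i : split (lshift k i) = inl i by exact: (unsplitK (inl i)).
have rE i : split (rshift n i) = inr i by exact: (unsplitK (inr i)).
rewrite !big_split_ord /=; split.
  under eq_bigr do rewrite lE.
  under [X in _ + X = _]eq_bigr do rewrite rE.
  by rewrite -!mulr_sumr u1 w1 !mulr1 addrC subrK.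
under [X in _ = X + _]eq_bigr do rewrite lE rmorphM -mulrA.
under [X in _ = _ + X]eq_bigr do rewrite rE rmorphM -mulrA.
by rewrite -!mulr_sumr.
Qed.

Lemma escape_radius (p : {poly CC}) : (2 < size p)%N ->
  exists R : RR, 0 < R /\ forall z, R <= cabs z -> 2 * cabs z <= cabs p.[z].
Proof.
move=> p2; have p1 := ltnW p2; have [us hus] := fiber_ex 0 p1.
have a0 := cabs_gt0 (lead_coef_neq0 p1); set a := cabs (lead_coef p) in a0.
have [M [M0 hM]] : exists M : RR, 0 <= M /\ forall u, u \in us -> cabs u <= M.
  elim: us {hus} => [|x us [M [M0 hM]]]; first by exists 0.
  exists (Num.max (cabs x) M); split=> [|u]; first by rewrite le_max M0 orbT.
  by rewrite in_cons le_max => /orP[/eqP ->|/hM ->]; rewrite ?lexx ?orbT.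
have ia0 : 0 < 8 / a by rewrite divr_gt0.
(* [2M] ensures [|z - u| >= |z| / 2] for each root [u], 2 ensures [|z| / 2 >= 1] so that the
   exponent [d] may be lowered to 2, and [8 / a] makes [a |z|^2 / 4 >= 2 |z|]. *)
exists (2 * M + 2 + 8 / a); split=> [|z hz]; first lra.
have h z' : z' = p.[z] - 0 -> a * (cabs z / 2) ^+ (size p).-1 <= cabs z'.
  move=> ->; rewrite (fiber_horner z hus) cabsM cabs_prod -/a ler_pM2l //.
  have -> : (cabs z / 2) ^+ (size p).-1 = \prod_(u <- us) (cabs z / 2).
    rewrite -(fiber_size p1 hus); elim: (us) => [|x s IH]; first by rewrite big_nil.
    by rewrite big_cons exprS IH.
  rewrite !big_seq ler_prod // => u hu; have c0 := cabs_ge0 z.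
  have := cabsD (z - u) u; rewrite subrK => h1; have := hM u hu.
  by move=> h2; apply/andP; split; lra.
apply: (le_trans _ (h _ (esym (subr0 _)))).
have z1 : 1 <= cabs z / 2 by lra.
apply: (@le_trans _ _ (a * (cabs z / 2) ^+ 2)); last first.
  by rewrite ler_pM2l // ler_weXn2l // -ltnS prednK // ltnW // ltnW.
have h8 : 8 <= a * cabs z.
  have : 8 / a <= cabs z by lra.
  by rewrite ler_pdivrMr // mulrC.
rewrite expr2; nra.
Qed.

Lemma escape_unbounded (p : {poly CC}) (R : RR) (z : CC) : 0 < R ->
  (forall z, R <= cabs z -> 2 * cabs z <= cabs p.[z]) -> R <= cabs z ->
  ~ filled_julia p z.
Proof.
move=> R0 hR hz [M hM].
(* Doubling beyond [R] adds at least [R] at each step; linear growth is enough. *)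
have grow n : R <= cabs (iter n (horner p) z) /\ n%:R * R <= cabs (iter n (horner p) z).
  elim: n => [|n [h1 h2]]; first by rewrite mul0r cabs_ge0.
  by have := hR _ h1; rewrite iterS -natr1 mulrDl mul1r; split; lra.
have [_ hb] := grow (Num.bound (`|M| / R)).
have M0 : 0 <= `|M| / R by rewrite divr_ge0 // ltW.
have := archi_boundP M0; rewrite ltr_pdivrMr // => h.
by have := hM (Num.bound (`|M| / R)); have := ler_norm M; lra.
Qed.

Lemma filled_julia_iter (p : {poly CC}) n z :
  filled_julia p z -> filled_julia p (iter n (horner p) z).
Proof. by move=> [M hM]; exists M => k; rewrite -iterD. Qed.

Lemma iter_horner_continuous (p : {poly CC}) n z (e : RR) : 0 < e ->
  exists r : RR, 0 < r /\ forall w, cabs (w - z) < r ->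
    cabs (iter n (horner p) w - iter n (horner p) z) < e.
Proof.
elim: n e => [|n IH] e e0; first by exists e.
set y := iter n (horner p) z.
have [B [B0 hB]] := horner_lipschitz p (cabs y + 1).
have [|r [r0 hr]] := IH (Num.min 1 (e / B)); first by rewrite lt_min ltr01 divr_gt0.
exists r; split=> // w /hr; rewrite lt_min -/y => /andP[w1 wr]; rewrite !iterS -/y.
apply: (le_lt_trans (hB _ _ _ _)).
- by have := cabsD y (iter n (horner p) w - y); rewrite addrC subrK; lra.
- by rewrite lerDl.
- by rewrite mulrC -ltr_pdivlMr.
Qed.

Lemma filled_julia_bounded (p : {poly CC}) : (2 < size p)%N ->
  exists D : RR, forall z, filled_julia p z -> cabs z <= D.
Proof.
move=> /escape_radius [R [R0 hR]]; exists R => z Kz.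
rewrite leNgt; apply/negP => /ltW hz; exact: (escape_unbounded R0 hR hz Kz).
Qed.

(** An unbounded orbit passes [R] at some time; by continuity of that iterate nearby orbits pass it
    too, and then escape. *)
Lemma filled_julia_closed (p : {poly CC}) z : (2 < size p)%N -> ~ filled_julia p z ->
  exists e : RR, 0 < e /\ forall w, cabs (w - z) < e -> ~ filled_julia p w.
Proof.
move=> /escape_radius [R [R0 hR]] nK.
have [n hn] : exists n, R < cabs (iter n (horner p) z).
  apply: contrapT => hn; apply: nK; exists R => n; rewrite leNgt; apply/negP => h.
  by apply: hn; exists n.
have e0 : 0 < cabs (iter n (horner p) z) - R by rewrite subr_gt0.
have [r [r0 hr]] := iter_horner_continuous p n z e0.
exists r; split=> // w /hr hw Kw.
apply: (escape_unbounded R0 hR _ (filled_julia_iter n Kw)).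
have := cabsD (iter n (horner p) z - iter n (horner p) w) (iter n (horner p) w).
by rewrite subrK (cabsB (iter n (horner p) z)); lra.
Qed.

Theorem mainTheorem7 (p : {poly CC}) (d : nat) :
  (size p).-1 = d -> (2 <= d)%N ->
  (forall z, hull_julia p z <-> hull_julia p p.[z]) ->
  (forall z, hull_julia p z <-> filled_julia p z) ->
  (exists (z0 : CC) (r : RR), 0 < r /\ forall w, cabs (w - z0) < r -> hull_julia p w) ->
  exists (a b c : CC), a != 0 /\ cabs c = 1 /\
    forall z : CC, p.[z] = (c * (a * z + b) ^+ d - b) / a.
Proof.
move=> pd d2 Hinv HK [z0 [r [r0 hr]]].
have p2 : (2 < size p)%N by move: d2; rewrite -pd; case: (size p) => [|[|[]]].
have [D hD] := filled_julia_bounded p2.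
have H : invariant_body p (hull_julia p) D.
  split=> //.
  - by move=> x y t; exact: conv_convex.
  - move=> z /(contra_not (proj2 (HK z))) /(filled_julia_closed p2)[e [e0 he]].
    by exists e; split=> // w /he hw /HK.
  - by move=> z /HK; exact: hD.
  - by exists z0, r.
have d1 : (0 < d.-1)%N by rewrite -ltnS prednK // ltnW.
have a0 := lead_coef_neq0 (ltnW p2).
(* Scaling by a root of [alpha^(d-1) = lead_coef p] normalises the leading coefficient, so [c = 1];
   the translation moves the barycentre to 0. *)
set g := barycenter p; set alpha := (d.-1).-root (lead_coef p).
have aE : alpha ^+ d.-1 = lead_coef p by exact: rootCK.
have alpha0 : alpha != 0 by rewrite rootC_eq0.
exists alpha, (- (alpha * g)), 1; split=> //; split=> [|z]; first exact: cabs1.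
rewrite (horner_invariant_body z H) pd -/g -aE mul1r opprK.
have -> : alpha * z - alpha * g = alpha * (z - g) by rewrite mulrBr.
have aD : alpha ^+ d = alpha ^+ d.-1 * alpha by rewrite -exprSr prednK // ltnW.
rewrite exprMn aD; field.
exact: alpha0.
Qed.
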